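(* There is an algorithm that, given a finite poset $(P,>)$, finds a largest cut of $P$, i.e. a cut $(B,U)$ for which $e(B,U)$ is maximum among all cuts of $P$, in time linear in $|(P,>)|$.
   Context: $(P,>)$ is a finite partially ordered set with strict order relation. For subsets $X,Y\subseteq P$ (not necessarily disjoint), $e(X,Y):=|\{(x,y) : x\in X,\ y\in Y,\ x<y\}|$. A cut in $(P,>)$ is an ordered partition $(B,U)$ of the set $P$, i.e. $B\cup U=P$ and $B\cap U=\emptyset$ (a part may be empty); its size is $e(B,U)$. $|(P,>)|$ denotes the size of the input poset, given as the list of its elements together with the list of all pairs $x<y$, i.e. $|P|+e(P,P)$; running time is counted in elementary operations in the standard unit-cost RAM model. *)

(* Defs.v *)
From HB Require Import structures.
From mathcomp Require Import all_boot all_order.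

Set Implicit Arguments.
Unset Strict Implicit.
Unset Printing Implicit Defensive.

(** * Cuts in finite posets *)

Section Cuts.

Variables (d : Order.disp_t) (P : finPOrderType d).

Definition edges (X Y : {set P}) : {set P * P} :=
  [set xy : P * P | [&& xy.1 \in X, xy.2 \in Y & (xy.1 < xy.2)%O]].

Definition e (X Y : {set P}) : nat := #|edges X Y|.

Definition is_cut (B U : {set P}) : Prop :=
  B :|: U = [set: P] /\ B :&: U = set0.

Definition largest_cut (B U : {set P}) : Prop :=
  is_cut B U /\ forall B' U' : {set P}, is_cut B' U' -> e B' U' <= e B U.

Definition poset_size : nat := #|P| + e [set: P] [set: P].

End Cuts.

(** * A unit-cost random access machine

    The machine has registers [R_0, R_1, ...], each holding a natural number
    of arbitrary size and initially [0], a read-only input tape and a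
    write-only output tape, both consisting of natural numbers.  Arithmetic is
    limited to addition and truncated subtraction, so that [t] steps lengthen
    the binary representation of the registers by [O(t)] bits only. *)

Inductive instr : Type :=
| Iconst of nat & nat          (* Iconst r k : R_r := k                       *)
| Imove of nat & nat           (* Imove r a  : R_r := R_a                     *)
| Iadd of nat & nat & nat      (* Iadd r a b : R_r := R_a + R_b               *)
| Isub of nat & nat & nat      (* Isub r a b : R_r := max (R_a - R_b) 0       *)
| Iload of nat & nat           (* Iload r a  : R_r := R_(R_a)                 *)
| Istore of nat & nat          (* Istore a r : R_(R_a) := R_r                 *)
| Iread of nat                 (* Iread r    : R_r := next input number       *)
| Iwrite of nat                (* Iwrite r   : append R_r to the output       *)
| Ijump of nat                 (* Ijump l    : go to instruction l            *)
| Ijzero of nat & nat          (* Ijzero r l : go to instruction l if R_r = 0 *)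
| Ihalt.                       (* the first instruction has number 0          *)

Definition program : Type := seq instr.

Record config : Type := Config {
  pc : nat;
  reg : nat -> nat;
  input : seq nat;
  output : seq nat
}.

Definition upd (m : nat -> nat) (a v : nat) : nat -> nat :=
  fun i => if i == a then v else m i.

(* A program counter outside the program also means [Ihalt]. *)
Definition current (p : program) (c : config) : instr := nth Ihalt p (pc c).

(* One elementary operation.  Halted configurations are fixed, and reading
   beyond the end of the input yields [0]. *)
Definition step (p : program) (c : config) : config :=
  let: Config l m i o := c in
  match current p c with
  | Iconst r k => Config l.+1 (upd m r k) i o
  | Imove r a => Config l.+1 (upd m r (m a)) i o
  | Iadd r a b => Config l.+1 (upd m r (m a + m b)) i o
  | Isub r a b => Config l.+1 (upd m r (m a - m b)) i o
  | Iload r a => Config l.+1 (upd m r (m (m a))) i o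
  | Istore a r => Config l.+1 (upd m (m a) (m r)) i o
  | Iread r => Config l.+1 (upd m r (head 0 i)) (behead i) o
  | Iwrite r => Config l.+1 m i (rcons o (m r))
  | Ijump l' => Config l' m i o
  | Ijzero r l' => Config (if m r == 0 then l' else l.+1) m i o
  | Ihalt => c
  end.

Definition init (x : seq nat) : config := Config 0 (fun=> 0) x [::].

Definition halted (p : program) (c : config) : Prop := current p c = Ihalt.

(* On input [x], [p] halts with output [y] after at most [t] steps. *)
Definition computes_within (p : program) (x y : seq nat) (t : nat) : Prop :=
  let c := iter t (step p) (init x) in halted p c /\ output c = y.

(** * Posets and cuts as data of the machine *)

Definition enumerates (T : finType) (s : seq T) (A : {set T}) : Prop :=
  uniq s /\ s =i A.

(* A list is preceded by its length, so that concatenations can be parsed. *)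
Definition encode_seq (T : Type) (name : T -> nat) (s : seq T) : seq nat :=
  size s :: [seq name x | x <- s].

Definition encode_pairs (T : Type) (name : T -> nat) (r : seq (T * T)) :
    seq nat :=
  size r :: flatten [seq [:: name xy.1; name xy.2] | xy <- r].

Definition encode_poset (T : Type) (name : T -> nat) (s : seq T)
    (r : seq (T * T)) : seq nat :=
  encode_seq name s ++ encode_pairs name r.

Definition encode_cut (T : Type) (name : T -> nat) (sB sU : seq T) : seq nat :=
  encode_seq name sB ++ encode_seq name sU.

(* Main.v *)
Require Import Defs.
From HB Require Import structures.
From mathcomp Require Import all_boot all_order zify.

Set Implicit Arguments.
Unset Strict Implicit.
Unset Printing Implicit Defensive.

(** The elements that have more elements above than below them form the bottom
    part of a largest cut.  Indeed, some optimal cut has a down-closed bottom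
    part [B], and the size of such a cut is the sum over [B] of the number of
    elements above minus the number of elements below; this sum is largest for
    the set of all its positive terms, which is itself down-closed.  Both
    numbers are found for all elements by a single pass through the list of
    pairs. *)

(** * Order theory: a largest cut read off from the numbers of elements above and below *)

Section LargestCut.

Variables (d : Order.disp_t) (P : finPOrderType d).
Implicit Types (B U X Y Z : {set P}) (x y : P).

Definition above x := #|[set y | (x < y)%O]|.
Definition below x := #|[set y | (y < x)%O]|.

Lemma eE X Y : e X Y = \sum_(x in X) \sum_(y in Y) (x < y)%O.
Proof.
rewrite /e /edges -sum1_card pair_big_dep /= big_mkcond [RHS]big_mkcond /=.
apply: eq_bigr => -[x y] _; rewrite inE /=.
by case: (x \in X); case: (y \in Y); case: (x < y)%O.
Qed.

Lemma sum_disjointU X Y (F : P -> nat) : [disjoint X & Y] ->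
  \sum_(x in X :|: Y) F x = \sum_(x in X) F x + \sum_(x in Y) F x.
Proof. by move=> dXY; rewrite -bigU //; apply: eq_bigl => x; rewrite !inE. Qed.

Lemma e_disjointUl X Y Z : [disjoint X & Y] -> e (X :|: Y) Z = e X Z + e Y Z.
Proof. by move=> dXY; rewrite !eE sum_disjointU. Qed.

Lemma e_disjointUr X Y Z : [disjoint X & Y] -> e Z (X :|: Y) = e Z X + e Z Y.
Proof.
move=> dXY; rewrite !eE -big_split; apply: eq_bigr => x _.
exact: sum_disjointU.
Qed.

Lemma e11 x : e [set x] [set x] = 0.
Proof. by rewrite eE !big_set1 Order.POrderTheory.ltxx. Qed.

Lemma e_above X : e X [set: P] = \sum_(x in X) above x.
Proof.
rewrite eE; apply: eq_bigr => x _.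
by rewrite /above -sum1_card big_mkcond [RHS]big_mkcond; apply: eq_bigr => y _;
   rewrite !inE; case: (_ < _)%O.
Qed.

Lemma e_below X : e [set: P] X = \sum_(x in X) below x.
Proof.
rewrite eE exchange_big; apply: eq_bigr => x _.
by rewrite /below -sum1_card big_mkcond [RHS]big_mkcond; apply: eq_bigr => y _;
   rewrite !inE; case: (_ < _)%O.
Qed.

(** Moving [y] to the top loses the pairs from [y] to the top and gains those from the rest of [B]
    to [y]. The balance is stated additively, which avoids truncated subtraction; counting [y]
    itself in [e B [set y]] is harmless by [e11]. *)
Lemma e_remove B y :
  y \in B ->
  e (B :\ y) (~: (B :\ y)) + e [set y] (~: B) = e B (~: B) + e B [set y].
Proof.
move=> yB; have dB : [disjoint [set y] & B :\ y].
  by rewrite disjoints1 !inE eqxx.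
have dU : [disjoint [set y] & ~: B] by rewrite disjoints1 !inE yB.
have -> : ~: (B :\ y) = [set y] :|: ~: B by rewrite setCD setUC.
have eB Z : e B Z = e [set y] Z + e (B :\ y) Z.
  by rewrite -{1}(setD1K yB) e_disjointUl.
rewrite !eB e_disjointUr // e11; lia.
Qed.

Lemma e_singleton_up x y X :
  (x < y)%O -> e [set y] X <= e [set x] X.
Proof.
move=> xy; rewrite !eE !big_set1; apply: leq_sum => z _.
by case: (boolP (y < z)%O) => // /(Order.POrderTheory.lt_trans xy) ->.
Qed.

Lemma e_singleton_down x y X :
  (x < y)%O -> e X [set x] <= e X [set y].
Proof.
move=> xy; rewrite !eE; apply: leq_sum => z _; rewrite !big_set1.
case: (boolP (z < x)%O) => // zx.
by rewrite (Order.POrderTheory.lt_trans zx xy).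
Qed.

Definition down_closed B := forall x y, (x < y)%O -> y \in B -> x \in B.

(* Among the cuts of maximum size take one with the smallest bottom part.  If
   [x < y] with [x] on top and [y] at the bottom, then moving [x] does not
   improve the cut and moving [y] strictly worsens it, so that
   [e x U <= e B x <= e B y < e y U <= e x U]. *)
Lemma exists_down_closed_optimum :
  exists2 D, down_closed D & forall B, e B (~: B) <= e D (~: D).
Proof.
(* A lexicographic objective: since [#|~: B|] is at most [#|P|], it only breaks ties between cuts of
   equal size, in favour of a larger top. *)
pose F B := e B (~: B) * #|P|.+1 + #|~: B|.
case: (@arg_maxnP _ set0 xpredT F isT) => D _ maxD.
have card_le B : #|B| <= #|P| by apply: max_card.
have maxe B : e B (~: B) <= e D (~: D).
  have := maxD B isT; rewrite /F; have := card_le (~: D); nia.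
exists D => // x y xy yD; apply: contraT => xD.
have worse : e (D :\ y) (~: (D :\ y)) < e D (~: D).
  have := maxD (D :\ y) isT; rewrite /F /= setCD.
  have -> : ~: D :|: [set y] = y |: ~: D by rewrite setUC.
  rewrite cardsU1 !inE yD /=; have := maxe (D :\ y); nia.
have xDx : x \in x |: D by rewrite !inE eqxx.
(* Moving [x] down is treated as the reverse of removing [x] from [x |: D]. *)
have := e_remove yD; have := e_remove xDx.
have -> : (x |: D) :\ x = D by rewrite setU1K.
have := maxe (x |: D).
rewrite [e (x |: D) [set x]]e_disjointUl ?disjoints1 // e11.
have ex : e [set x] (~: D) = e [set x] (~: (x |: D)).
  have -> : ~: D = [set x] :|: ~: (x |: D).
    by apply/setP => z; rewrite !inE; case: eqP => [->|].
  by rewrite e_disjointUr ?disjoints1 ?inE ?eqxx // e11.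
have := e_singleton_up (~: D) xy; have := e_singleton_down D xy; lia.
Qed.

(** No pair goes from the top to the bottom, so the sum of [below] counts exactly the pairs inside
    [B]; the sum of [above] counts these and the pairs of the cut. *)
Lemma e_down_closed B :
  down_closed B ->
  e B (~: B) + \sum_(x in B) below x = \sum_(x in B) above x.
Proof.
move=> dB; have dBC : [disjoint B & ~: B] by rewrite disjoints_subset setCK.
rewrite -e_above -e_below -(setUCr B) e_disjointUl // e_disjointUr //.
suff -> : e (~: B) B = 0 by lia.
rewrite eE big1 // => x; rewrite inE => xB; rewrite big1 // => y yB.
by case: (boolP (x < y)%O) => // /dB /(_ yB); rewrite (negPf xB).
Qed.

Lemma above_decr x y : (x < y)%O -> above y <= above x.
Proof.
move=> xy; apply/subset_leq_card/subsetP => z.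
by rewrite !inE => /(Order.POrderTheory.lt_trans xy).
Qed.

Lemma below_incr x y : (x < y)%O -> below x <= below y.
Proof.
move=> xy; apply/subset_leq_card/subsetP => z.
by rewrite !inE => /Order.POrderTheory.lt_trans; apply.
Qed.

Lemma largest_cut_degrees (H := [set x | below x < above x]) :
  largest_cut H (~: H).
Proof.
split=> [|B U [BU BU0]]; first by rewrite /is_cut setUCr setICr.
have -> : U = ~: B.
  apply/setP=> x; move/setP/(_ x): BU; move/setP/(_ x): BU0.
  by rewrite !inE; case: (x \in B); case: (x \in U).
have [D dD /(_ B)/leq_trans] := exists_down_closed_optimum; apply.
have dH : down_closed H.
  by move=> x y xy; rewrite !inE; have := above_decr xy; have := below_incr xy; lia.
(* Truncated subtraction is the positive part of the difference, so the terms outside [H] vanish. *)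
have -> : e H (~: H) = \sum_x (above x - below x).
  have eH := e_down_closed dH.
  rewrite [in RHS](bigID (mem H)) /= [X in _ = _ + X]big1 => [|x]; last first.
    by rewrite inE; lia.
  have sumH : \sum_(x in H) above x =
      \sum_(x in H) (above x - below x) + \sum_(x in H) below x.
    by rewrite -big_split; apply: eq_bigr => x; rewrite inE /=; lia.
  by apply: (@addIn (\sum_(x in H) below x)); rewrite addn0 eH sumH.
rewrite -(leq_add2r (\sum_(x in D) below x)) e_down_closed //.
apply: (@leq_trans (\sum_(x in D) (above x - below x) + \sum_(x in D) below x)).
  by rewrite -big_split; apply: leq_sum => x _ /=; lia.
by rewrite leq_add2r [leqRHS](bigID (mem D)) leq_addr.
Qed.

End LargestCut.

(** * Executions with upper bounds on the number of steps *)

Definition exec (a : instr) (c : config) : config :=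
  let: Config l m i o := c in
  match a with
  | Iconst r k => Config l.+1 (upd m r k) i o
  | Imove r a => Config l.+1 (upd m r (m a)) i o
  | Iadd r a b => Config l.+1 (upd m r (m a + m b)) i o
  | Isub r a b => Config l.+1 (upd m r (m a - m b)) i o
  | Iload r a => Config l.+1 (upd m r (m (m a))) i o
  | Istore a r => Config l.+1 (upd m (m a) (m r)) i o
  | Iread r => Config l.+1 (upd m r (head 0 i)) (behead i) o
  | Iwrite r => Config l.+1 m i (rcons o (m r))
  | Ijump l' => Config l' m i o
  | Ijzero r l' => Config (if m r == 0 then l' else l.+1) m i o
  | Ihalt => c
  end.

Lemma stepE p c : step p c = exec (current p c) c.
Proof. by case: c. Qed.

Definition reaches (p : program) (t : nat) (c c' : config) : Prop :=
  exists2 k, k <= t & iter k (step p) c = c'.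

Lemma reaches_refl p t c : reaches p t c c.
Proof. by exists 0. Qed.

Lemma reaches_step p t c c' :
  reaches p t (exec (current p c) c) c' -> reaches p t.+1 c c'.
Proof. by case=> k kt kc; exists k.+1; rewrite ?iterSr ?stepE. Qed.

Lemma reaches_trans p t1 t2 c1 c2 c3 :
  reaches p t1 c1 c2 -> reaches p t2 c2 c3 -> reaches p (t1 + t2) c1 c3.
Proof.
move=> [k1 kt1 <-] [k2 kt2 <-]; exists (k2 + k1); last by rewrite iterD.
by rewrite addnC leq_add.
Qed.

Lemma reaches_weaken p t t' c c' : t <= t' -> reaches p t c c' -> reaches p t' c c'.
Proof. by move=> tt' [k kt kc]; exists k => //; apply: leq_trans tt'. Qed.

(** [computes_within] runs exactly [t] steps, [reaches] at most [t]; the surplus steps do nothing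
    because a halted configuration is fixed. *)
Lemma reaches_computes p t x c y :
  reaches p t (init x) c -> halted p c -> output c = y ->
  computes_within p x y t.
Proof.
move=> [k kt kc] hc yc; rewrite /computes_within -(subnK kt) iterD kc.
suff -> : iter (t - k) (step p) c = c by [].
by elim: (t - k) => //= j ->; rewrite stepE hc; case: (c).
Qed.

Lemma computes_within_weaken p x y t t' :
  t <= t' -> computes_within p x y t -> computes_within p x y t'.
Proof.
by move=> tt' [hc yc]; apply: reaches_computes hc yc; exists t.
Qed.

(* Registers below 16 are scalars; among them, 2 counts the remaining rounds of
   a loop, 3 holds the current name and 10 points into the list of names.  From
   16 on, three arrays are interleaved, so that names of any size can be used
   as addresses without collisions: the numbers of elements above and below
   the element named [x], and the list of all names.  Indices are tripled by
   addition, the machine having no product. *)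
Record memory (n c : nat) (up dn : nat -> nat) (names : seq nat)
    (m : nat -> nat) : Prop := Memory {
  mem_size : m 1 = n;
  mem_one : m 6 = 1;
  mem_three : m 7 = 3;
  mem_up_base : m 8 = 16;
  mem_dn_base : m 9 = 17;
  mem_count : m 11 = c;
  mem_up : forall x, m (16 + (x + x + x)) = up x;
  mem_dn : forall x, m (17 + (x + x + x)) = dn x;
  mem_names : forall i, m (18 + (i + i + i)) = nth 0 names i
}.

(** * The program *)

Variant action := Skip | Count | Emit.

(** [Skip] is a dummy move, so that every action occupies one instruction and jump targets and step
    counts do not depend on it. *)
Definition action_instr (a : action) : instr :=
  match a with
  | Skip => Imove 0 0
  | Count => Iadd 11 11 6
  | Emit => Iwrite 3
  end.

(* [co] consists of the counter in register 11 and of the output tape. *)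
Definition action_effect (a : action) (x : nat) (co : nat * seq nat) :=
  match a with
  | Skip => co
  | Count => (co.1.+1, co.2)
  | Emit => (co.1, rcons co.2 x)
  end.

Definition read_elements : program :=
  [:: Iconst 6 1; Iconst 7 3; Iconst 8 16; Iconst 9 17;
      Iread 1; Imove 2 1; Iconst 10 18;
      Ijzero 2 13;
      Iread 3; Istore 10 3; Iadd 10 10 7; Isub 2 2 6; Ijump 7].

Definition read_pairs : program :=
  [:: Iread 2;
      Ijzero 2 31;
      Iread 3; Iadd 4 3 3; Iadd 4 4 3; Iadd 4 8 4;
      Iload 5 4; Iadd 5 5 6; Istore 4 5;
      Iread 3; Iadd 4 3 3; Iadd 4 4 3; Iadd 4 9 4;
      Iload 5 4; Iadd 5 5 6; Istore 4 5;
      Isub 2 2 6; Ijump 14].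

(* [l] is the number of the first instruction, for the jumps. *)
Definition scan (l : nat) (aB aU : action) : program :=
  [:: Imove 2 1; Iconst 10 18;
      Ijzero 2 (18 + l);
      Iload 3 10; Iadd 10 10 7; Isub 2 2 6;
      Iadd 4 3 3; Iadd 4 4 3; Iadd 5 8 4; Iadd 4 9 4;
      Iload 5 5; Iload 4 4; Isub 5 5 4;
      Ijzero 5 (16 + l);
      action_instr aB; Ijump (2 + l);
      action_instr aU; Ijump (2 + l)].

(** Each output list must be preceded by its length, hence three scans: one to count the bottom
    elements, then one to emit each part. The length of the top is obtained by subtraction. *)
Definition cut_program : program :=
  read_elements ++ read_pairs ++
  scan 31 Count Skip ++ [:: Iwrite 11] ++
  scan 50 Emit Skip ++ [:: Isub 12 1 11; Iwrite 12] ++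
  scan 70 Skip Emit.

(** * Address arithmetic and the two reading loops *)

Arguments upd m a v i /.

Lemma low_address r b x :
  r < b -> ((r == b + x) = false) * ((b + x == r) = false).
Proof.
by move=> rb; rewrite eq_sym; split; apply/negbTE; rewrite neq_ltn ltn_addr ?orbT.
Qed.

Lemma triple_inj b x y : (b + (x + x + x) == b + (y + y + y)) = (x == y).
Proof. by rewrite eqn_add2l; apply/eqP/eqP; lia. Qed.

Lemma triple_neq a b x y :
  a != b %[mod 3] -> (a + (x + x + x) == b + (y + y + y)) = false.
Proof.
by move=> ab; apply/eqP => exy; case/negP: ab; apply/eqP; lia.
Qed.

(** These rules decide the address comparisons left by [upd]: within one array, between two arrays
    (the bases 16, 17 and 18 differ modulo 3), and between a scalar and an array cell. *)
Definition address := (triple_inj, triple_neq, low_address).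

Ltac run M := apply: reaches_step; rewrite /= ?M ?address //=.

Lemma read_name_step n c up dn names x i o m :
  memory n c up dn names m ->
  0 < m 2 -> m 10 = 18 + (size names + size names + size names) ->
  exists m',
    [/\ reaches cut_program 6 (Config 7 m (x :: i) o) (Config 7 m' i o),
        memory n c up dn (rcons names x) m',
        m' 2 = (m 2).-1
      & m' 10 = 18 + ((size names).+1 + (size names).+1 + (size names).+1)].
Proof.
move=> M m2 m10; have R := (mem_one M, mem_three M, m10).
eexists; split.
- apply: reaches_step; rewrite /= eqn0Ngt m2 /=.
  do 5 run R.
  exact: reaches_refl.
- case: M => ? ? ? ? ? ? mU mD mN; split=> [||||||y|y|j]; rewrite /= ?address // nth_rcons.
  (* Cells beyond the stored names hold 0, which is also the default value of [nth]. *)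
  by case: (ltngtP j (size names)) => // lt_j; rewrite mN nth_default // ltnW.
- by rewrite /= subn1.
- by rewrite /=; lia.
Qed.

Lemma read_names n c up dn xs names i o m :
  memory n c up dn names m ->
  m 2 = size xs -> m 10 = 18 + (size names + size names + size names) ->
  exists2 m', reaches cut_program (6 * size xs + 1) (Config 7 m (xs ++ i) o)
                (Config 13 m' i o)
            & memory n c up dn (names ++ xs) m'.
Proof.
elim: xs names m => [|x xs IH] names m M m2 m10.
  exists m; last by rewrite cats0.
  by apply: reaches_step; rewrite /= m2; apply: reaches_refl.
have [|m1 [r1 M1 m12 m110]] := read_name_step x (xs ++ i) o M _ m10.
  by rewrite m2.
have [| |m' r' M'] := IH _ _ M1; first by rewrite m12 m2.
  by rewrite size_rcons.
exists m'; last by rewrite -cat_rcons.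
by rewrite /= mulnS -addnA; apply: reaches_trans r1 r'.
Qed.

Lemma count_pair_step n c up dn names x y i o m :
  memory n c up dn names m -> 0 < m 2 ->
  exists m',
    [/\ reaches cut_program 17 (Config 14 m [:: x, y & i] o)
          (Config 14 m' i o),
        memory n c (fun z => up z + (x == z)) (fun z => dn z + (y == z))
          names m'
      & m' 2 = (m 2).-1].
Proof.
move=> M m2.
have R := (mem_one M, mem_up_base M, mem_dn_base M, mem_up M, mem_dn M).
eexists; split.
- apply: reaches_step; rewrite /= eqn0Ngt m2 /=.
  do 16 run R.
  exact: reaches_refl.
- case: M => ? ? ? ? ? ? mU mD mN; split=> [||||||z|z|j]; rewrite /= ?address //.
    by rewrite eq_sym; case: eqP => [->|] //; rewrite ?addn0 ?addn1.
  by rewrite eq_sym; case: eqP => [->|] //; rewrite ?addn0 ?addn1.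
- by rewrite /= ?address //= subn1.
Qed.

(** The final arrays [up'] and [dn'] are specified pointwise, so no equality between functions has
    to be proved. *)
Lemma count_pairs n c up dn names q i o m :
  memory n c up dn names m -> m 2 = size q ->
  exists up' dn' m',
    [/\ reaches cut_program (17 * size q + 1)
          (Config 14 m (flatten [seq [:: xy.1; xy.2] | xy <- q] ++ i) o)
          (Config 31 m' i o),
        memory n c up' dn' names m',
        forall z, up' z = up z + count (fun xy => xy.1 == z) q
      & forall z, dn' z = dn z + count (fun xy => xy.2 == z) q].
Proof.
elim: q up dn m => [|[x y] q IH] up dn m M m2.
  exists up, dn, m; split=> // [|z|z]; rewrite ?addn0 //.
  by apply: reaches_step; rewrite /= m2; apply: reaches_refl.
have [|m1 [r1 M1 m12]] := count_pair_step x y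
    (flatten [seq [:: xy.1; xy.2] | xy <- q] ++ i) o M _.
  by rewrite m2.
have [|up' [dn' [m' [r' M' upE dnE]]]] := IH _ _ _ M1.
  by rewrite m12 m2.
exists up', dn', m'; split=> // [|z|z]; last 2 first.
- by rewrite upE addnA.
- by rewrite dnE addnA.
by rewrite /= mulnS -addnA; apply: reaches_trans r1 r'.
Qed.

(** * The scan of the names, verified once for any position in a program *)

Definition code_at (p : program) (l : nat) (b : program) : Prop :=
  forall k, k < size b -> nth Ihalt p (k + l) = nth Ihalt b k.

Lemma code_at_cat p1 b p2 : code_at (p1 ++ b ++ p2) (size p1) b.
Proof.
by move=> k ks; rewrite nth_cat ltnNge leq_addl addnK /= nth_cat ks.
Qed.

Lemma scan_step p l aB aU n c up dn names k x i o m :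
  code_at p l (scan l aB aU) ->
  memory n c up dn names m -> 0 < m 2 -> m 10 = 18 + (k + k + k) ->
  nth 0 names k = x ->
  let co := action_effect (if dn x < up x then aB else aU) x (c, o) in
  exists m',
    [/\ reaches p 14 (Config (2 + l) m i o) (Config (2 + l) m' i co.2),
        memory n co.1 up dn names m',
        m' 2 = (m 2).-1
      & m' 10 = 18 + (k.+1 + k.+1 + k.+1)].
Proof.
move=> code M m2 m10 nth_k /=.
have cur j m' i' o' : j < 18 ->
    current p (Config (j + l) m' i' o') = nth Ihalt (scan l aB aU) j.
  exact: code.
case: (M) => ? ? ? ? ? mC mU mD mN; have mk := mN k; rewrite nth_k in mk.
have R := (mem_one M, mem_three M, mem_up_base M, mem_dn_base M, mU, mD, mk, m10).
(* The machine can only test for zero; truncated subtraction turns this test into a comparison. *)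
have : (up x - dn x == 0) = ~~ (dn x < up x) by rewrite subn_eq0 leqNgt.
case: (dn x < up x) => test; [case: aB cur {code}|case: aU cur {code}] => cur.
all: eexists; split; [
  do 11 (apply: reaches_step; rewrite cur //= ?eqn0Ngt ?m2 ?R ?address //= -?addSn);
  apply: reaches_step; rewrite cur //= test /= -?addSn;
  do 2 (apply: reaches_step; rewrite cur //= ?R -?addSn);
  exact: reaches_refl
| split=> [||||||y|y|j]; rewrite /= ?address ?mC ?addn1 //
| by rewrite /= subn1
| by rewrite /=; lia].
Qed.

(** Induction on the unread suffix [t] of [names], with [k] the number of names already scanned. The
    extra step is the final test that leaves the loop. *)
Lemma scan_loop p l aB aU n c up dn names t k i o m :
  code_at p l (scan l aB aU) ->
  memory n c up dn names m -> m 2 = size t -> m 10 = 18 + (k + k + k) ->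
  drop k names = t ->
  let co := foldl (fun co x =>
    action_effect (if dn x < up x then aB else aU) x co) (c, o) t in
  exists2 m',
    reaches p (14 * size t + 1) (Config (2 + l) m i o) (Config (18 + l) m' i co.2)
  & memory n co.1 up dn names m'.
Proof.
move=> code; elim: t k c o m => [|x t IH] k c o m M m2 m10 drop_k.
  exists m => //; apply: reaches_step.
  by rewrite /current code //= m2; apply: reaches_refl.
have lt_k : k < size names.
  by rewrite ltnNge; apply/negP => /drop_oversize; rewrite drop_k.
have [nth_k drop_k1] : nth 0 names k = x /\ drop k.+1 names = t.
  by move: drop_k; rewrite (drop_nth 0 lt_k) => -[].
have [|m1 [r1 M1 m12 m110]] := scan_step i o code M _ m10 nth_k.
  by rewrite m2.
rewrite /=; move: r1 M1; case: (action_effect _ _ _) => c1 o1 r1 M1.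
have [|m' r' M'] := IH _ c1 o1 _ M1 _ m110 drop_k1; first by rewrite m12 m2.
by exists m' => //; rewrite mulnS -addnA; apply: reaches_trans r1 r'.
Qed.

Lemma scan_names p l aB aU c up dn names i o m :
  code_at p l (scan l aB aU) -> memory (size names) c up dn names m ->
  let co := foldl (fun co x =>
    action_effect (if dn x < up x then aB else aU) x co) (c, o) names in
  exists2 m',
    reaches p (14 * size names + 3) (Config l m i o) (Config (18 + l) m' i co.2)
  & memory (size names) co.1 up dn names m'.
Proof.
move=> code M.
have [||||m' r' M'] := @scan_loop p l aB aU (size names) c up dn names names 0 i o
    (upd (upd m 2 (m 1)) 10 18) code.
- by case: M => ? ? ? ? ? ? mU mD mN; split=> [||||||y|y|j]; rewrite /= ?address.
- by rewrite /= (mem_size M).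
- by [].
- exact: drop0.
exists m' => //; rewrite addnS addn2.
apply: reaches_step; rewrite /current (code 0) //=.
apply: reaches_step; rewrite /current (code 1) //=.
by rewrite -addn1.
Qed.

Lemma foldl_count (q : pred nat) c o t :
  foldl (fun co x => action_effect (if q x then Count else Skip) x co) (c, o) t
  = (c + count q t, o).
Proof.
elim: t c => [|x t IH] c /=; first by rewrite addn0.
by case: (q x); rewrite /= IH ?add0n // addSnnS.
Qed.

Lemma foldl_emit_true (q : pred nat) c o t :
  foldl (fun co x => action_effect (if q x then Emit else Skip) x co) (c, o) t
  = (c, o ++ filter q t).
Proof.
elim: t o => [|x t IH] o /=; first by rewrite cats0.
by case: (q x); rewrite /= IH // cat_rcons.
Qed.

Lemma foldl_emit_false (q : pred nat) c o t :
  foldl (fun co x => action_effect (if q x then Skip else Emit) x co) (c, o) t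
  = (c, o ++ filter (predC q) t).
Proof.
elim: t o => [|x t IH] o /=; first by rewrite cats0.
by case: (q x); rewrite /= IH // cat_rcons.
Qed.

(** * Correctness and running time of the whole program *)

Lemma cut_program_computes (names : seq nat) (q : seq (nat * nat)) :
  let bottom x := count (fun xy => xy.2 == x) q < count (fun xy => xy.1 == x) q in
  let sB := filter bottom names in
  let sU := filter (predC bottom) names in
  computes_within cut_program
    ((size names :: names) ++
      size q :: flatten [seq [:: xy.1; xy.2] | xy <- q])
    ((size sB :: sB) ++ (size sU :: sU))
    (48 * size names + 17 * size q + 22).
Proof.
move=> bottom sB sU.
set tail := size q :: _.
pose m0 : nat -> nat := upd (upd (upd (upd (upd (upd (upd (fun=> 0) 6 1) 7 3) 8 16) 9 17)
  1 (size names)) 2 (size names)) 10 18.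
have r0 : reaches cut_program 7 (init ((size names :: names) ++ tail))
    (Config 7 m0 (names ++ tail) [::]).
  by do 7 (apply: reaches_step; rewrite /=); apply: reaches_refl.
have M0 : memory (size names) 0 (fun=> 0) (fun=> 0) [::] m0.
  by split=> [||||||y|y|j]; rewrite /= ?address // nth_nil.
have [||m1 r1 M1] := read_names tail [::] M0 (xs := names); [by [] | by [] |].
have M2 : memory (size names) 0 (fun=> 0) (fun=> 0) names (upd m1 2 (size q)).
  by case: M1 => ? ? ? ? ? ? mU mD mN; split=> [||||||y|y|j]; rewrite /= ?address.
have r2 : reaches cut_program 1 (Config 13 m1 tail [::])
    (Config 14 (upd m1 2 (size q)) (behead tail) [::]).
  by apply: reaches_step; rewrite /=; apply: reaches_refl.
have [|up [dn [m3 [r3 M3 upE dnE]]]] := count_pairs (q := q) [::] [::] M2.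
  by [].
rewrite cats0 in r3.
have bottomE x : (dn x < up x) = bottom x by rewrite upE dnE.
have code1 : code_at cut_program 31 (scan 31 Count Skip).
  exact: (code_at_cat (read_elements ++ read_pairs)).
have code2 : code_at cut_program 50 (scan 50 Emit Skip).
  exact: (code_at_cat (read_elements ++ read_pairs ++ scan 31 Count Skip ++ [:: Iwrite 11])).
have code3 : code_at cut_program 70 (scan 70 Skip Emit).
  have := @code_at_cat (take 70 cut_program) (scan 70 Skip Emit) [::].
  by rewrite cats0 cat_take_drop.
have := scan_names [::] [::] code1 M3.
rewrite foldl_count (eq_count bottomE) -size_filter => -[m4 r4 M4].
have r5 : reaches cut_program 1 (Config 49 m4 [::] [::])
    (Config 50 m4 [::] [:: size sB]).
  by apply: reaches_step; rewrite /= (mem_count M4); apply: reaches_refl.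
have := scan_names [::] [:: size sB] code2 M4.
rewrite foldl_emit_true (eq_filter bottomE) => -[m6 r6 M6].
have sizeU : size names - size sB = size sU.
  by rewrite !size_filter -(count_predC bottom names) addKn.
have r7 : reaches cut_program 2 (Config 68 m6 [::] (size sB :: sB))
    (Config 70 (upd m6 12 (size sU)) [::] (rcons (size sB :: sB) (size sU))).
  apply: reaches_step; rewrite /= (mem_count M6) (mem_size M6) /= add0n sizeU.
  by apply: reaches_step; apply: reaches_refl.
have M7 : memory (size names) (0 + size sB) up dn names (upd m6 12 (size sU)).
  by case: M6 => ? ? ? ? ? ? mU mD mN; split=> [||||||y|y|j]; rewrite /= ?address.
have := scan_names [::] (rcons (size sB :: sB) (size sU)) code3 M7.
rewrite foldl_emit_false => -[m8 r8 _].
(* The program has 88 instructions, so counter 88 lies just past its end and means [Ihalt]. *)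
apply: (reaches_computes (c := Config 88 m8 [::] ((size sB :: sB) ++ size sU :: sU))) => //.
have := reaches_trans r0 (reaches_trans r1 (reaches_trans r2 (reaches_trans r3
  (reaches_trans r4 (reaches_trans r5 (reaches_trans r6 (reaches_trans r7 r8))))))).
rewrite /= cat_rcons (eq_filter (a2 := predC bottom)) => [|x]; last by rewrite /= bottomE.
(* Each name costs 6 steps for reading and 14 in each of the three scans, 48 in all; each pair costs
   17; the remaining 22 steps are set-up, loop exits and the writing of lengths. *)
by apply: reaches_weaken; lia.
Qed.

Theorem mainTheorem2 :
  exists (A : program) (C : nat),
    forall (d : Order.disp_t) (P : finPOrderType d) (name : P -> nat)
           (s : seq P) (r : seq (P * P)),
      injective name ->
      enumerates s [set: P] ->
      enumerates r [set xy : P * P | (xy.1 < xy.2)%O] ->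
      exists (B U : {set P}) (sB sU : seq P),
        [/\ largest_cut B U,
            enumerates sB B,
            enumerates sU U
          & computes_within A (encode_poset name s r) (encode_cut name sB sU)
              (C * (poset_size P).+1)].
Proof.
(* The constant 48 is the largest of the coefficients 48, 17 and 22 in the step bound. *)
exists cut_program, 48 => d P name s r name_inj [s_uniq sP] [r_uniq rP].
pose B := [set x : P | below x < above x].
exists B, (~: B), [seq x <- s | x \in B], [seq x <- s | x \notin B]; split.
- exact: largest_cut_degrees.
- by split=> [|x]; rewrite ?filter_uniq // mem_filter sP in_setT andbT.
- by split=> [|x]; rewrite ?filter_uniq // mem_filter sP in_setT andbT in_setC.
pose names := [seq name x | x <- s].
pose q := [seq (name xy.1, name xy.2) | xy <- r].
have aboveE x : count (fun xy => xy.1 == name x) q = above x.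
  rewrite count_map -size_filter -(card_uniqP (filter_uniq _ r_uniq)).
  (* The map [pair x] identifies the elements above [x] with the listed pairs whose first component
     is [x]. *)
  have inj : injective (pair x : P -> P * P) by move=> y z [].
  rewrite /above -(card_imset _ inj); apply: eq_card => -[y z].
  rewrite mem_filter rP inE /= (inj_eq name_inj).
  apply/andP/imsetP => [[/eqP -> /[!inE] xz]|[t /[!inE] xt [-> ->]] //=].
  by exists z; rewrite ?inE.
have belowE x : count (fun xy => xy.2 == name x) q = below x.
  rewrite count_map -size_filter -(card_uniqP (filter_uniq _ r_uniq)).
  have inj : injective (fun y : P => (y, x)) by move=> y z [].
  rewrite /below -(card_imset _ inj); apply: eq_card => -[y z].
  rewrite mem_filter rP inE /= (inj_eq name_inj).
  apply/andP/imsetP => [[/eqP -> /[!inE] yx]|[t /[!inE] tx [-> ->]] //=].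
  by exists y; rewrite ?inE.
have sizeE : poset_size P = size s + size r.
  rewrite /poset_size -cardsT -(card_uniqP s_uniq) -(card_uniqP r_uniq).
  congr (_ + _); first exact/esym/eq_card.
  by apply: eq_card => xy; rewrite rP !inE.
have := cut_program_computes names q.
set bottom := fun x => _ < _ => /=.
have bottomE x : bottom (name x) = (x \in B) by rewrite /bottom aboveE belowE inE.
rewrite /encode_poset /encode_cut /encode_seq /encode_pairs !size_map !filter_map.
have topE : preim name (predC bottom) =1 (fun x => x \notin B).
  by move=> x; rewrite -bottomE.
rewrite (eq_filter bottomE) (eq_filter topE) !size_map -map_comp.
by apply: computes_within_weaken; rewrite sizeE; lia.
Qed.
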